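(* Let $n,m$ be positive integers, let $E\subset\mathbb{R}^n$ be a non-empty compact set and let $s,\gamma>0$. Let $(\Omega,\mathcal{F},\mathbb{P})$ be a probability space and let $\{f_\omega:E\to\mathbb{R}^m,\ \omega\in\Omega\}$ be a family of continuous mappings such that $(\omega,x)\mapsto f_\omega(x)$ is $\sigma(\mathcal{F}\times\mathcal{B})$-measurable, where $\mathcal{B}$ denotes the Borel sets, and such that for some $c>0$ $$\mathbb{P}\big(|f_\omega(x)-f_\omega(y)|\le r\big)\le c\,\phi_{r^\gamma}^s(x-y)\qquad(x,y\in E,\ r>0).$$ Then, for $\mathbb{P}$-almost all $\omega\in\Omega$, $$\underline{\dim}_{\rm B} f_\omega(E)\ge\gamma\,\underline{\dim}_{\rm B}^{\,s}E\quad\text{and}\quad \overline{\dim}_{\rm B} f_\omega(E)\ge\gamma\,\overline{\dim}_{\rm B}^{\,s}E .$$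
   Context: For $s>0$ and $r>0$ let $\phi_r^s(x)=\min\{1,(r/|x|)^s\}$ for $x\in\mathbb{R}^n$ (with $\phi_r^s(0)=1$). For non-empty compact $E\subset\mathbb{R}^n$ let $\mathcal{M}(E)$ be the set of Borel probability measures supported by $E$. The capacity $C_r^s(E)$ is defined by $$\frac{1}{C_r^s(E)}=\inf_{\mu\in\mathcal{M}(E)}\int\int\phi_r^s(x-y)\,d\mu(x)\,d\mu(y).$$ The lower and upper $s$-box dimension profiles of $E$ are $$\underline{\dim}_{\rm B}^{\,s}E=\liminf_{r\to0}\frac{\log C_r^s(E)}{-\log r},\qquad \overline{\dim}_{\rm B}^{\,s}E=\limsup_{r\to0}\frac{\log C_r^s(E)}{-\log r}.$$ For a non-empty compact set $A$ in a Euclidean space let $N_r(A)$ be the minimum number of sets of diameter $r$ that can cover $A$. The lower and upper box-counting dimensions of $A$ are $$\underline{\dim}_{\rm B}A=\liminf_{r\to0}\frac{\log N_r(A)}{-\log r},\qquad \overline{\dim}_{\rm B}A=\limsup_{r\to0}\frac{\log N_r(A)}{-\log r}.$$ *)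

(* Defs.v *)
From HB Require Import structures.
From mathcomp Require Import all_boot all_order all_algebra.
From mathcomp Require Import all_classical all_reals all_analysis.

Set Implicit Arguments.
Unset Strict Implicit.
Unset Printing Implicit Defensive.

Import Order.TTheory GRing.Theory Num.Theory.
Import numFieldTopology.Exports numFieldNormedType.Exports.

Local Open Scope classical_set_scope.
Local Open Scope ring_scope.

(* The library's topology on 'rV[R]_n is that of the sup norm, which is the
   Euclidean topology; distances, however, have to be Euclidean. *)
Definition enorm (R : realType) (n : nat) (x : 'rV[R]_n) : R :=
  Num.sqrt (\sum_(i < n) x ord0 i ^+ 2).

(* R^n with its Borel sigma-algebra. *)
Notation borel_rV R n := (g_sigma_algebraType (@open 'rV[R]_n)).

(* The value at 0 is set apart because division by 0 returns 0. *)
Definition phi (R : realType) (n : nat) (s r : R) (x : 'rV[R]_n) : R :=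
  if x == 0 then 1 else Num.min 1 ((r / enorm x) `^ s).

Definition probability_on (R : realType) (n : nat) (E : set 'rV[R]_n) :
    set (probability (borel_rV R n) R) :=
  [set mu | mu E = 1%E].

Definition energy (R : realType) (n : nat) (s r : R)
    (mu : probability (borel_rV R n) R) : \bar R :=
  (\int[mu]_y \int[mu]_x
     (phi s r ((x : 'rV[R]_n) - (y : 'rV[R]_n)))%:E)%E.

(* For compact nonempty E the infimum lies in ]0, 1], so that the inverse is
   that of a positive real number. *)
Definition capacity (R : realType) (n : nat) (s r : R) (E : set 'rV[R]_n) :
    \bar R :=
  ((ereal_inf [set energy s r mu | mu in probability_on E])^-1)%E.

Definition lower_dim_profile (R : realType) (n : nat) (s : R)
    (E : set 'rV[R]_n) : \bar R :=
  limf_einf (fun r : R => (lne (capacity s r E) / (- ln r)%:E)%E) 0^'+.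

Definition upper_dim_profile (R : realType) (n : nat) (s : R)
    (E : set 'rV[R]_n) : \bar R :=
  limf_esup (fun r : R => (lne (capacity s r E) / (- ln r)%:E)%E) 0^'+.

Definition diam (R : realType) (m : nat) (U : set 'rV[R]_m) : \bar R :=
  ereal_sup [set (enorm (x - y))%:E | x in U & y in U].

Definition coverable (R : realType) (m : nat) (r : R) (A : set 'rV[R]_m)
    (k : nat) : Prop :=
  exists U : 'I_k -> set 'rV[R]_m,
    (forall i, diam (U i) = r%:E) /\ A `<=` \bigcup_i U i.

(* The infimum is +oo when there is no finite cover; otherwise it is attained
   and is the least number of sets in a cover. *)
Definition covering_number (R : realType) (m : nat) (r : R)
    (A : set 'rV[R]_m) : \bar R :=
  ereal_inf [set k%:R%:E | k in coverable r A].

Definition lower_box_dim (R : realType) (m : nat) (A : set 'rV[R]_m) : \bar R :=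
  limf_einf (fun r : R => (lne (covering_number r A) / (- ln r)%:E)%E) 0^'+.

Definition upper_box_dim (R : realType) (m : nat) (A : set 'rV[R]_m) : \bar R :=
  limf_esup (fun r : R => (lne (covering_number r A) / (- ln r)%:E)%E) 0^'+.

(* Main.v *)
Require Import Defs.
From HB Require Import structures.
From mathcomp Require Import all_boot all_order all_algebra.
From mathcomp Require Import all_classical all_reals all_analysis.
From mathcomp Require Import measurable_realfun.
From mathcomp Require Import ring lra.

Set Implicit Arguments.
Unset Strict Implicit.
Unset Printing Implicit Defensive.

Import Order.TTheory GRing.Theory Num.Theory.
Import numFieldTopology.Exports numFieldNormedType.Exports.

Local Open Scope classical_set_scope.
Local Open Scope ring_scope.

(** Energies are transported by the random map. If [mu] is a probability on [E],
    Fubini's theorem and the hypothesis on pairs of points give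
      E [(mu x mu) {(x, y) : |f x - f y| <= r}] <= c * energy s (r ^ gamma) mu,
    and choosing [mu] almost minimal makes the right-hand side at most
    2c / C(r ^ gamma), where C is the capacity ([expected_close_pairs],
    [near_min_energy]).

    A cover of [f(E)] by N sets of diameter r cuts [E] into N pieces within
    which any two points have images at distance at most r. The squares of the
    measures of the pieces add up to at least 1/N by Cauchy-Schwarz, so the
    pairs of points with images at distance at most r have product measure at
    least 1/N ([coverable_close_pairs]).

    Apply this to the radii exp(-k). The expectations, divided by the minimal
    energies, are bounded uniformly in k, so that after weighting them by the
    summable sequence 1/((k+1)(k+2)) their sum is almost surely finite: up to
    a random constant, the measure of the close pairs at radius exp(-k) exceeds
    1 / C(exp(-k) ^ gamma) by a factor of at most (k+1)(k+2) ([ae_quadratic_bound]).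
    As the minimal energy grows at most like a power of the radius
    ([min_energy_scale]), passing from exp(-k) to an arbitrary r costs
    only a constant factor, and
      C(r ^ gamma) <= N_r (f(E)) * K * (- ln r + 2)^2    for all r in ]0, 1[.
    After taking logarithms and dividing by - ln r, the last two factors
    contribute a term that tends to 0, and the substitution of r ^ gamma for r
    produces the factor gamma ([box_dim_ge_profile]). *)

(** * Limits along powers of the radius *)

Lemma near0_powR (R : realType) (g : R) (V : set R) : 0 < g ->
  (\forall r \near 0^'+, V r) -> \forall r \near 0^'+, V (r `^ g).
Proof.
move=> g_gt0 V0; have /= V1 := powR_cvg0 g_gt0 V0.
near=> r; have r0 : 0 < r by [].
have : 0 < r `^ g -> V (r `^ g) by near: r; exact: V1.
by apply; exact: powR_gt0.
Unshelve. all: by end_near. Qed.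

(** The substitution r -> r ^ g and its inverse preserve the filter of right
    neighbourhoods of 0, so it changes neither limit; stating the comparison
    up to every positive [e] absorbs the error terms. *)
Lemma limf_einf_esup_powR (R : realType) (a b : R -> \bar R) (g : R) :
  0 < g ->
  (forall e : R, 0 < e ->
     \forall r \near (0 : R)^'+, (g%:E * a (r `^ g)%R <= b r + e%:E)%E) ->
  (g%:E * limf_einf a 0^'+ <= limf_einf b 0^'+)%E /\
  (g%:E * limf_esup a 0^'+ <= limf_esup b 0^'+)%E.
Proof.
move=> g0 ab; split; apply/lee_addgt0Pr => e e0.
- rewrite -lee_pdivlMl// !limf_einfE; apply: ge_ereal_sup => _ [V V0 <-].
  rewrite lee_pdivlMl// -leeBlDr//; apply: le_ereal_sup_tmp.
  pose W := [set r : R | V (r `^ g) /\ (g%:E * a (r `^ g)%R <= b r + e%:E)%E].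
  exists (ereal_inf (b @` W)).
    exists W => //; apply: filterI; [exact: near0_powR|exact: ab].
  apply: le_ereal_inf_tmp => _ [r [Vr abr] <-].
  rewrite leeBlDr//; apply: le_trans abr; rewrite lee_pmul2l//.
  by apply: ereal_inf_lbound; exists (r `^ g)%R.
- rewrite -leeBlDr// !limf_esupE; apply: le_ereal_inf_tmp => _ [V V0 <-].
  rewrite leeBlDr// -lee_pdivlMl//; apply: ge_ereal_inf.
  (* the supremum of [a] is taken over the points u = r ^ g with r in V *)
  pose W := [set u : R | 0 < u /\ (V `&`
    [set r : R | (g%:E * a (r `^ g)%R <= b r + e%:E)%E]) (u `^ g^-1)].
  exists (ereal_sup (a @` W)).
    exists W => //; apply: filterI; first exact: nbhs_right_gt.
    by apply: near0_powR; [rewrite invr_gt0|apply: filterI => //; exact: ab].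
  apply: ge_ereal_sup => _ [u [u0 [Vu abu]] <-].
  move: abu; rewrite /mkset -powRrM mulVf ?gt_eqF// (powRr1 (ltW u0)) => abu.
  rewrite lee_pdivlMl//; apply: le_trans abu _; rewrite leeD2r//.
  by apply: ereal_sup_ubound; exists (u `^ g^-1).
Qed.

(** A power of [- ln r] is negligible against [r ^ (- e)]. *)
Lemma ln_quadratic_small (R : realType) (K e : R) : 0 < K -> 0 < e ->
  \forall r \near 0^'+, ln (K * (- ln r + 2) ^+ 2) <= e * - ln r.
Proof.
move=> K0 e0.
(* With L = - ln r, the claim follows from 9 K L ^ 2 <= (e L) ^ 3 / 6, a term
   of the exponential series of e L, because L + 2 <= 3 L for L >= 1. The
   summand 1 in L0 ensures L >= 1, and 54 = 9 * 6. *)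
pose L0 := K * 54 / e ^+ 3 + 1 : R.
near=> r.
have r0 : 0 < r by [].
have rL : r <= expR (- L0).
  by near: r; apply: nbhs_right_le; exact: expR_gt0.
have L0gt0 : 1 <= L0.
  by rewrite /L0 lerDr divr_ge0 ?exprn_ge0 ?mulr_ge0 ?ltW.
have LL : L0 <= - ln r.
  by rewrite lerNr -[leRHS]expRK ler_ln ?posrE ?expR_gt0.
set L := - ln r in LL *.
have L1 : 1 <= L by exact: (le_trans L0gt0 LL).
have Lp : 0 < L by exact: lt_le_trans ltr01 L1.
rewrite -[leRHS]expRK ler_ln ?posrE ?expR_gt0//; last first.
  by rewrite mulr_gt0// exprn_gt0// addr_gt0.
have := @expR_ge1Dxn _ (e * L) 2 (mulr_ge0 (ltW e0) (ltW Lp)).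
rewrite (_ : 3`!%:R = 6)// => H.
apply: le_trans H.
apply: (@le_trans _ _ ((e * L) ^+ 3 / 6)); last by rewrite lerDr.
rewrite ler_pdivlMr// exprMn.
have LK : K * 54 <= e ^+ 3 * L.
  rewrite [leRHS]mulrC -ler_pdivrMr ?exprn_gt0//; apply: le_trans LL.
  by rewrite /L0 lerDl.
have L2 : (L + 2) ^+ 2 <= 9 * L ^+ 2 by nra.
apply: (@le_trans _ _ (K * 54 * L ^+ 2)); first nra.
rewrite (_ : _ * L ^+ 3 = e ^+ 3 * L * L ^+ 2); last by ring.
by rewrite ler_pM2r// exprn_gt0.
Unshelve. all: by end_near. Qed.

(** * The Euclidean norm *)

Lemma enorm_ge0 (R : realType) (n : nat) (x : 'rV[R]_n) : 0 <= enorm x.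
Proof. exact: sqrtr_ge0. Qed.

Lemma enorm_eq0 (R : realType) (n : nat) (x : 'rV[R]_n) :
  (enorm x == 0) = (x == 0).
Proof.
rewrite sqrtr_eq0; apply/idP/eqP => [s0|->]; last first.
  by rewrite big1// => i _; rewrite mxE expr0n.
have /psumr_eq0P x0 : \sum_(i < n) x ord0 i ^+ 2 = 0.
  by apply/eqP; rewrite eq_le s0 sumr_ge0// => i _; exact: sqr_ge0.
apply/rowP => i; rewrite mxE; apply/eqP; rewrite -sqrf_eq0.
by rewrite x0// => j _; exact: sqr_ge0.
Qed.

Lemma enorm_le_norm (R : realType) (n : nat) (x : 'rV[R]_n) (B : R) :
  `|x| <= B -> enorm x <= Num.sqrt (n%:R * B ^+ 2).
Proof.
move=> xB; rewrite ler_wsqrtr//.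
apply: (@le_trans _ _ (\sum_(i < n) B ^+ 2)); last first.
  by rewrite sumr_const card_ord mulr_natl.
apply: ler_sum => i _; rewrite -[leLHS]ger0_norm ?sqr_ge0// normrX.
rewrite ler_pXn2r ?nnegrE//; last exact: le_trans xB.
apply: le_trans xB; rewrite [leRHS]/Num.Def.normr/= mx_normrE.
exact: (le_bigmax _ (fun ij => `|x ij.1 ij.2|) (ord0, i)).
Qed.

Lemma enorm_continuous (R : realType) (n : nat) : continuous (@enorm R n).
Proof.
move=> x; apply: continuous_comp; last exact: sqrt_continuous.
move: x; apply: continuous_big => [|i _ x]; first exact: add_continuous.
apply: (continuous_comp (f := fun x : 'rV[R]_n => x ord0 i)
  (g := fun t : R => t ^+ 2)); first exact: coord_continuous.
exact: exprn_continuous.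
Qed.

(** Closing the sets of a cover makes them Borel without enlarging their
    diameters. *)
Lemma closure_enormB_le (R : realType) (m : nat) (U : set 'rV[R]_m) (r : R)
    (x y : 'rV[R]_m) :
  (diam U <= r%:E)%E -> closure U x -> closure U y -> enorm (x - y) <= r.
Proof.
move=> Ur Ux Uy.
have cl (z : 'rV[R]_m) : closed [set x | enorm (x - z) <= r].
  have cz : continuous (fun x : 'rV[R]_m => enorm (x - z)).
    move=> t; apply: (continuous_comp (f := fun x : 'rV[R]_m => x - z)).
      apply: (@continuousB _ _ _ (fun x : 'rV[R]_m => x) (cst z)).
        exact: cvg_id.
      exact: cst_continuous.
    exact: enorm_continuous.
  exact: (preimage_closed (f := fun x : 'rV[R]_m => enorm (x - z))
    (D := [set t | t <= r]) (fun x _ => cz x) (@closed_le _ r)).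
have step (V : set 'rV[R]_m) z : (forall v, V v -> enorm (v - z) <= r) ->
    forall v, closure V v -> enorm (v - z) <= r.
  move=> Vz; suff: closure V `<=` [set v | enorm (v - z) <= r] by [].
  by rewrite closureE; exact: smallest_sub.
(* first one point of the pair moves to the closure, then the other *)
apply: (step U y _ x Ux) => v Uv.
have e_sym (a b : 'rV[R]_m) : enorm (a - b) = enorm (b - a).
  rewrite /enorm; congr (Num.sqrt _); apply: eq_bigr => i _.
  by rewrite -opprB mxE sqrrN.
rewrite e_sym; apply: (step U v _ y Uy) => u Uu.
rewrite -lee_fin; apply: le_trans Ur; apply: ereal_sup_ubound.
by exists u => //; exists v.
Qed.

Lemma compact_enormB_bounded (R : realType) (n : nat) (E : set 'rV[R]_n) :
  compact E ->
  exists2 D : R, 0 < D & forall x y, E x -> E y -> enorm (x - y) <= D.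
Proof.
move=> /compact_bounded[M [_ MB]].
pose N := `|M| + 1.
have NB x : E x -> `|x| <= N.
  by move=> Ex; apply: MB => //; rewrite /N (le_lt_trans (ler_norm M))// ltrDl.
exists (Num.sqrt (n%:R * (N + N) ^+ 2) + 1).
  by rewrite ltr_wpDl// sqrtr_ge0.
move=> x y Ex Ey.
apply: (@le_trans _ _ (Num.sqrt (n%:R * (N + N) ^+ 2))); last by rewrite lerDl.
by apply: enorm_le_norm; rewrite (le_trans (ler_normB _ _))// lerD// NB.
Qed.

(** * Borel measurability *)

Lemma measurable_continuous_rV (R : realType) (n : nat) (f : 'rV[R]_n -> R) :
  continuous f -> measurable_fun [set: borel_rV R n] (f : borel_rV R n -> R).
Proof.
move=> /continuousP cf.
apply: (measurability _ (RGenOpens.measurableE R)).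
move=> _ [_ [x [y ->]] <-]; rewrite setTI.
by apply: sub_sigma_algebra; exact: cf (interval_open _ _).
Qed.

Lemma measurable_closed_rV (R : realType) (n : nat) (A : set 'rV[R]_n) :
  closed A -> measurable (A : set (borel_rV R n)).
Proof.
move=> cA; rewrite -(setCK A); apply: measurableC.
by apply: sub_sigma_algebra; exact: closed_openC.
Qed.

Lemma measurable_compact_rV (R : realType) (n : nat) (E : set 'rV[R]_n) :
  compact E -> measurable (E : set (borel_rV R n)).
Proof.
move=> cE; apply: measurable_closed_rV; apply: compact_closed cE.
exact: norm_hausdorff.
Qed.

(** Going through the coordinates avoids comparing the Borel sigma-algebra of
    the product space with the product of the Borel sigma-algebras. *)
Lemma measurable_enormB (R : realType) (n : nat) d (T : measurableType d)
    (D : set T) (g h : T -> borel_rV R n) :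
  measurable_fun D g -> measurable_fun D h ->
  measurable_fun D (fun t => enorm ((g t : 'rV[R]_n) - (h t : 'rV[R]_n))).
Proof.
move=> mg mh; apply: (@measurableT_comp _ _ _ _ _ _ (@Num.sqrt R)).
  by apply: continuous_measurable_fun; exact: sqrt_continuous.
apply: measurable_sum => i; apply: measurable_funX.
have mc : measurable_fun [set: borel_rV R n] (fun x : 'rV[R]_n => x ord0 i).
  by apply: measurable_continuous_rV; exact: coord_continuous.
under eq_fun do rewrite !mxE.
apply: measurable_funB; [exact: (measurableT_comp mc mg)|].
exact: (measurableT_comp mc mh).
Qed.

(** * The kernel *)

Lemma phi_ge0 (R : realType) (n : nat) (s r : R) (x : 'rV[R]_n) :
  0 <= phi s r x.
Proof. by rewrite /phi; case: ifP => // _; rewrite le_min ler01 powR_ge0. Qed.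

Lemma phi_le1 (R : realType) (n : nat) (s r : R) (x : 'rV[R]_n) :
  phi s r x <= 1.
Proof. by rewrite /phi; case: ifP => // _; rewrite ge_min lexx. Qed.

(** Enlarging the radius enlarges the kernel by a bounded factor; this lets a
    geometric sequence of radii control all the others. *)
Lemma phi_scale (R : realType) (n : nat) (s r l : R) (x : 'rV[R]_n) :
  0 < s -> 0 < r -> 1 <= l -> phi s (l * r) x <= l `^ s * phi s r x.
Proof.
move=> s0 r0 l1; have l0 : 0 < l by exact: lt_le_trans l1.
have ls1 : 1 <= l `^ s by rewrite -(powRr0 l) ler_powR// ltW.
rewrite /phi; case: ifP => [_|_]; first by rewrite mulr1.
rewrite minr_pMr ?powR_ge0// mulr1 -mulrA.
rewrite powRM ?(ltW l0) ?divr_ge0 ?enorm_ge0 ?(ltW r0)//.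
by rewrite le_min ge_min ls1/= ge_min lexx orbT.
Qed.

Lemma phi_ge_bounded (R : realType) (n : nat) (s r D : R) (x : 'rV[R]_n) :
  0 < s -> 0 < r -> 0 < D -> enorm x <= D ->
  Num.min 1 ((r / D) `^ s) <= phi s r x.
Proof.
move=> s0 r0 D0 xD; rewrite /phi.
case: ifPn => [_|x0]; first by rewrite ge_min lexx.
have ex0 : 0 < enorm x by rewrite lt_neqAle eq_sym enorm_eq0 x0 enorm_ge0.
rewrite le_min ge_min lexx/= ge_min; apply/orP; right.
apply: ge0_ler_powR;
  rewrite ?nnegrE ?(ltW s0) ?divr_ge0 ?(ltW r0) ?(ltW D0) ?enorm_ge0//.
by rewrite ler_pM2l// lef_pV2 ?posrE.
Qed.

Lemma measurable_phi (R : realType) (n : nat) (s r : R) : 0 < r ->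
  measurable_fun [set: borel_rV R n * borel_rV R n]
   (fun p => phi s r ((p.1 : 'rV[R]_n) - (p.2 : 'rV[R]_n))).
Proof.
move=> r0.
have -> : (fun p : borel_rV R n * borel_rV R n =>
     phi s r ((p.1 : 'rV[R]_n) - (p.2 : 'rV[R]_n))) =
   (fun t : R => if t == 0 then 1 else Num.min 1 (r `^ s * t `^ (- s))) \o
   (fun p => enorm ((p.1 : 'rV[R]_n) - (p.2 : 'rV[R]_n))).
  apply/funext => p; rewrite /phi /= enorm_eq0; case: ifP => // _.
  rewrite powRM ?invr_ge0 ?enorm_ge0 ?ltW//.
  by rewrite -powR_inv1 ?enorm_ge0// -powRrM mulN1r.
apply: measurableT_comp.
  2: exact: measurable_enormB measurable_fst measurable_snd.
apply: measurable_fun_ifT => //.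
  exact: measurable_fun_eqr.
by apply: measurable_minr => //; exact: measurable_funM.
Qed.

(** * Energies and capacities *)

Lemma energyE (R : realType) (n : nat) (s r : R)
    (mu : probability (borel_rV R n) R) : 0 < r ->
  energy s r mu =
  (\int[mu \x mu]_p (phi s r ((p.1 : 'rV[R]_n) - (p.2 : 'rV[R]_n)))%:E)%E.
Proof.
move=> r0; rewrite fubini_tonelli2//.
- by apply/measurable_EFinP; exact: measurable_phi.
- by move=> p; rewrite lee_fin phi_ge0.
Qed.

Lemma energy_scale (R : realType) (n : nat) (s r l : R)
    (mu : probability (borel_rV R n) R) : 0 < s -> 0 < r -> 1 <= l ->
  (energy s (l * r) mu <= (l `^ s)%:E * energy s r mu)%E.
Proof.
move=> s0 r0 l1; have l0 : 0 < l by exact: lt_le_trans ltr01 l1.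
rewrite !energyE ?mulr_gt0//.
have mphi t : 0 < t -> measurable_fun [set: borel_rV R n * borel_rV R n]
    (fun p => (phi s t ((p.1 : 'rV[R]_n) - (p.2 : 'rV[R]_n)))%:E).
  by move=> t0; apply/measurable_EFinP; exact: measurable_phi.
rewrite -ge0_integralZl//; last 3 first.
- exact: mphi.
- by move=> p _; rewrite lee_fin phi_ge0.
- by rewrite lee_fin powR_ge0.
apply: ge0_le_integral => //.
- by move=> p _; rewrite lee_fin phi_ge0.
- by apply: mphi; exact: mulr_gt0.
- by apply: measurable_funeM; exact: mphi.
- by move=> p _; rewrite -EFinM lee_fin phi_scale.
Qed.

Definition min_energy (R : realType) (n : nat) (s r : R) (E : set 'rV[R]_n) :
  \bar R := ereal_inf [set energy s r mu | mu in probability_on E].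

Lemma min_energy_scale (R : realType) (n : nat) (s r l : R)
    (E : set 'rV[R]_n) : 0 < s -> 0 < r -> 1 <= l ->
  (min_energy s (l * r) E <= (l `^ s)%:E * min_energy s r E)%E.
Proof.
move=> s0 r0 l1; have l0 : 0 < l by exact: lt_le_trans ltr01 l1.
rewrite -lee_pdivrMl ?powR_gt0//; apply: le_ereal_inf_tmp => _ [mu muE <-].
rewrite lee_pdivrMl ?powR_gt0//; apply: le_trans (energy_scale _ s0 r0 l1).
by apply: ereal_inf_lbound; exists mu.
Qed.

Lemma min_energy_le1 (R : realType) (n : nat) (s r : R) (E : set 'rV[R]_n) :
  E !=set0 -> 0 < r -> (min_energy s r E <= 1)%E.
Proof.
move=> [x Ex] r0.
pose mu : probability (borel_rV R n) R := @dirac _ (borel_rV R n) x R.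
apply: (@le_trans _ _ (energy s r mu)).
  apply: ereal_inf_lbound; exists mu => //=.
  by rewrite /probability_on/= diracE mem_set.
rewrite energyE//; apply: (@le_trans _ _ (\int[mu \x mu]_p 1)%E).
  apply: ge0_le_integral => //.
  - by move=> p _; rewrite lee_fin phi_ge0.
  - by apply/measurable_EFinP; exact: measurable_phi.
  - by move=> p _; rewrite lee_fin phi_le1.
by rewrite integral_cst// mul1e; exact: probability_le1.
Qed.

(** The kernel is bounded away from 0 on differences of points of [E], because
    [E] is bounded. *)
Lemma min_energy_gt0 (R : realType) (n : nat) (s r : R) (E : set 'rV[R]_n) :
  compact E -> 0 < s -> 0 < r -> (0 < min_energy s r E)%E.
Proof.
move=> cE s0 r0; have mE := measurable_compact_rV cE.
have [D D0 ED] := compact_enormB_bounded cE.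
pose m := Num.min 1 ((r / D) `^ s).
have m0 : 0 < m by rewrite lt_min ltr01 powR_gt0// divr_gt0.
apply: (@lt_le_trans _ _ m%:E); first by rewrite lte_fin.
apply: le_ereal_inf_tmp => _ [mu muE <-].
rewrite energyE//.
have mphi : measurable_fun [set: borel_rV R n * borel_rV R n]
    (fun p => (phi s r ((p.1 : 'rV[R]_n) - (p.2 : 'rV[R]_n)))%:E).
  by apply/measurable_EFinP; exact: measurable_phi.
pose EE : set (borel_rV R n * borel_rV R n) := E `*` E.
have mEE : measurable EE by exact: measurableX.
have -> : m%:E = (\int[mu \x mu]_(p in EE) m%:E)%E.
  rewrite integral_cst// -[LHS]mule1; congr (_ * _)%E; apply/esym.
  rewrite -[RHS]mule1 -[X in (X * _)%E]muE -[X in (_ * X)%E]muE.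
  exact: product_measure1E.
apply: (@le_trans _ _ (\int[mu \x mu]_(p in EE)
    (phi s r ((p.1 : 'rV[R]_n) - (p.2 : 'rV[R]_n)))%:E)%E).
  apply: ge0_le_integral => //.
  - by move=> p _; rewrite lee_fin ltW.
  - exact: measurable_funTS.
  - by move=> [x y] [Ex Ey]; rewrite lee_fin phi_ge_bounded// ED.
apply: ge0_subset_integral => //.
by move=> p _; rewrite lee_fin phi_ge0.
Qed.

(** A positive infimum is nearly attained up to a factor, which
    spares the compactness argument for the existence of a minimiser. *)
Lemma near_min_energy (R : realType) (n : nat) (s r : R) (E : set 'rV[R]_n) :
  compact E -> E !=set0 -> 0 < s -> 0 < r ->
  exists2 mu, probability_on E mu &
    (energy s r mu <= 2%:E * min_energy s r E)%E.
Proof.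
move=> cE E0 s0 r0; have e0 := min_energy_gt0 cE s0 r0.
have e1 := @min_energy_le1 _ _ s _ _ E0 r0.
have efin : min_energy s r E \is a fin_num.
  by rewrite ge0_fin_numE ?ltW// (le_lt_trans e1)// ltry.
have [|_ [mu muE <-] lt2] :=
    lb_ereal_inf_adherent _ efin (e := fine (min_energy s r E)).
  by rewrite fine_gt0// e0 (le_lt_trans e1)// ltry.
exists mu => //; apply: ltW; rewrite (lt_le_trans lt2)//.
by rewrite fineK// mule_natl.
Qed.

Lemma capacityE (R : realType) (n : nat) (s r : R) (E : set 'rV[R]_n) :
  compact E -> E !=set0 -> 0 < s -> 0 < r ->
  exists2 e : R, 0 < e & min_energy s r E = e%:E /\ capacity s r E = (e^-1)%:E.
Proof.
move=> cE E0 s0 r0; have e0 := min_energy_gt0 cE s0 r0.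
have e1 := @min_energy_le1 _ _ s _ _ E0 r0.
rewrite /capacity -/(min_energy s r E).
move: (min_energy s r E) e0 e1 => [e| |]//; rewrite lte_fin => e0 _.
by exists e; rewrite // inver gt_eqF.
Qed.

(** * Counting covers with a product measure *)

(** The Cauchy-Schwarz inequality against a constant vector, in the form that
    [k * a i - 1] has a nonnegative sum of squares. *)
Lemma inv_card_le_sum_sqr (R : realType) (k : nat) (a : 'I_k -> R) :
  \sum_i a i = 1 -> 1 <= k%:R * \sum_i a i ^+ 2.
Proof.
move=> a1.
have k0 : k%:R != 0 :> R.
  rewrite pnatr_eq0; apply/eqP => k0; move: a a1; rewrite k0 => a.
  by rewrite big_ord0 => /eqP; rewrite eq_sym oner_eq0.
have : 0 <= \sum_i (k%:R * a i - 1) ^+ 2.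
  by apply: sumr_ge0 => i _; exact: sqr_ge0.
have -> : \sum_i (k%:R * a i - 1) ^+ 2 =
    k%:R * (k%:R * \sum_i a i ^+ 2 - 1) :> R.
  rewrite (eq_bigr (fun i => k%:R ^+ 2 * a i ^+ 2 - (2 * k%:R) * a i + 1)).
    rewrite big_split/= big_split/= -mulr_sumr sumrN -mulr_sumr a1.
    by rewrite sumr_const card_ord -mulr_natl; ring.
  by move=> i _; ring.
by rewrite pmulr_rge0 ?subr_ge0// lt0r k0/=.
Qed.

(** Once the pieces are made disjoint, their squares are disjoint subsets of
    [S] whose measures are the squares of numbers that add up to 1. *)
Lemma card_mul_product_ge1 d (X : measurableType d) (R : realType)
    (mu : probability X R) (k : nat) (B : 'I_k -> set X) (S : set (X * X)) :
  (forall i, measurable (B i)) -> measurable S ->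
  mu (\bigcup_i B i) = 1%E -> (forall i, B i `*` B i `<=` S) ->
  (1 <= k%:R%:E * (mu \x mu) S)%E.
Proof.
move=> mB mS muB BS.
(* [B] is extended by the empty set to a sequence, which [seqDU] makes
   disjoint *)
pose A (i : nat) := if insub i is Some j then B j else set0.
have mA i : measurable (A i) by rewrite /A; case: insubP.
pose F := seqDU A.
have mF i : measurable (F i).
  by apply: measurableD => //; exact: bigsetU_measurable.
have F1 : (\sum_(i < k) mu (F i) = 1)%E.
  rewrite -measure_bigsetU//; last exact: trivIset_seqDU.
  rewrite -(bigsetU_seqDU A) -muB; congr (mu _).
  rewrite -bigcup_mkord; apply/seteqP; split => [x [i/= ik Aix]|x [i _ Bix]].
    by exists (Ordinal ik) => //; move: Aix; rewrite /A insubT.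
  by exists i => //=; rewrite /A valK.
have FFS i : F i `*` F i `<=` S.
  move=> [x y] [/= [Ax _] [Ay _]]; move: Ax Ay; rewrite /A.
  by case: insubP => // j _ _ Bx By; exact: (BS j).
have FS : (\sum_(i < k) mu (F i) * mu (F i) <= (mu \x mu) S)%E.
  under eq_bigr do rewrite -product_measure1E//.
  have tF : trivIset setT (fun i => F i `*` F i).
    apply/trivIsetP => i j _ _ ij; apply/seteqP.
    split => // -[x y] [[Fx _] [Fy _]].
    have /trivIsetP/(_ i j Logic.I Logic.I ij) := trivIset_seqDU A.
    by move=> /seteqP[+ _] => /(_ x); apply.
  have mFF i : measurable (F i `*` F i) by exact: measurableX.
  have <- := measure_bigsetU (mu \x mu)%E mFF tF k.
  apply: le_measure; rewrite ?inE//.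
    by apply: bigsetU_measurable => i _; exact: measurableX.
  elim/big_ind: _ => [|U V US VS|i _]; [exact: sub0set| |exact: FFS].
  by rewrite subUset.
apply: le_trans (lee_wpmul2l _ FS); rewrite ?lee_fin//.
have muf i : mu (F i) = (fine (mu (F i)))%:E by rewrite fineK// fin_num_measure.
move: F1; under eq_bigr do rewrite muf.
rewrite sumEFin => -[F1].
under eq_bigr do rewrite muf -EFinM -expr2.
by rewrite sumEFin -EFinM lee_fin; exact: inv_card_le_sum_sqr F1.
Qed.

(** * Close pairs of a random map *)

(** The parameter is kept as a coordinate, so that exchanging the expectation
    with the integrals over the pairs is one use of Fubini's theorem for the
    two kinds of sections of this set. *)
Definition close_pairs (R : realType) (n m : nat) (E : set 'rV[R]_n)
    (d : measure_display) (Omega : measurableType d)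
    (f : Omega -> 'rV[R]_n -> 'rV[R]_m) (r : R) :
    set (Omega * (borel_rV R n * borel_rV R n)) :=
  [set q | [/\ E q.2.1, E q.2.2 & enorm (f q.1 q.2.1 - f q.1 q.2.2) <= r]].

Lemma measurable_close_pairs (R : realType) (n m : nat) (E : set 'rV[R]_n)
    (d : measure_display) (Omega : measurableType d)
    (f : Omega -> 'rV[R]_n -> 'rV[R]_m) (r : R) :
  measurable (E : set (borel_rV R n)) ->
  measurable_fun ([set: Omega] `*` E : set (Omega * borel_rV R n))
    (fun p : Omega * borel_rV R n => f p.1 p.2 : borel_rV R m) ->
  measurable (close_pairs E f r).
Proof.
move=> mE f_measurable.
pose D : set (Omega * (borel_rV R n * borel_rV R n)) := setT `*` (E `*` E).
have mD : measurable D by apply: measurableX => //; exact: measurableX.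
have mfst : measurable_fun D (fun q => f q.1 q.2.1 : borel_rV R m).
  have := (measurable_comp
    (f := fun p : Omega * borel_rV R n => f p.1 p.2 : borel_rV R m)
    (g := fun q : Omega * (borel_rV R n * borel_rV R n) => (q.1, q.2.1))
    _ _ f_measurable) => /(_ D); apply.
  - exact: measurableX.
  - by move=> _ [q [_ [Eq _]] <-].
  - apply: measurable_funTS; apply: measurable_fun_pair => //.
    exact: measurableT_comp.
have msnd : measurable_fun D (fun q => f q.1 q.2.2 : borel_rV R m).
  have := (measurable_comp
    (f := fun p : Omega * borel_rV R n => f p.1 p.2 : borel_rV R m)
    (g := fun q : Omega * (borel_rV R n * borel_rV R n) => (q.1, q.2.2))
    _ _ f_measurable) => /(_ D); apply.
  - exact: measurableX.
  - by move=> _ [q [_ [_ Eq]] <-].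
  - apply: measurable_funTS; apply: measurable_fun_pair => //.
    exact: measurableT_comp.
have -> : close_pairs E f r =
    D `&` (fun q => enorm (f q.1 q.2.1 - f q.1 q.2.2)) @^-1` `]-oo, r].
  by apply/seteqP; split => [[w [x y]] []|[w [x y]] [[_ []]]] /=;
    rewrite in_itv.
exact: measurable_enormB mfst msnd _ _ _.
Qed.

(** By Fubini's theorem the left-hand side is the integral, over the pairs
    (x, y) in [E], of the probability that their images are close. *)
Lemma expected_close_pairs (R : realType) (n m : nat) (E : set 'rV[R]_n)
    (d : measure_display) (Omega : measurableType d) (P : probability Omega R)
    (f : Omega -> 'rV[R]_n -> 'rV[R]_m) (mu : probability (borel_rV R n) R)
    (c s r g : R) :
  measurable (E : set (borel_rV R n)) ->
  measurable_fun ([set: Omega] `*` E : set (Omega * borel_rV R n))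
    (fun p : Omega * borel_rV R n => f p.1 p.2 : borel_rV R m) ->
  0 < c -> 0 < r ->
  (forall x y : 'rV[R]_n, E x -> E y ->
     (P [set w | (enorm (f w x - f w y) <= r)%R] <=
        (c * phi s (r `^ g) (x - y))%:E)%E) ->
  (\int[P]_w (mu \x mu) (xsection (close_pairs E f r) w) <=
    c%:E * energy s (r `^ g) mu)%E.
Proof.
move=> mE f_measurable c0 r0 fP; have rg0 := powR_gt0 g r0.
have mA := measurable_close_pairs r mE f_measurable.
have := @indic_fubini_tonelli _ _ _ _ _ P
  [the probability _ _ of (mu \x mu)%E] _ mA.
rewrite indic_fubini_tonelli_FE// indic_fubini_tonelli_GE//= => ->.
rewrite energyE//.
have mphi : measurable_fun [set: borel_rV R n * borel_rV R n]
    (fun p => (phi s (r `^ g) ((p.1 : 'rV[R]_n) - (p.2 : 'rV[R]_n)))%:E).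
  by apply/measurable_EFinP; apply: measurable_phi.
rewrite -ge0_integralZl//; last 2 first.
- by move=> p _; rewrite lee_fin phi_ge0.
- by rewrite lee_fin ltW.
apply: ge0_le_integral => //.
- exact: measurable_fun_ysection.
- exact: measurable_funeM.
move=> [x y] _ /=.
have [[Ex Ey]|nE] := pselect (E x /\ E y).
  rewrite -EFinM; apply: le_trans (fP x y Ex Ey).
  rewrite le_eqVlt; apply/orP; left; apply/eqP; congr (P _).
  by apply/seteqP; split => w; rewrite /ysection/= inE/=; [case|split].
rewrite (_ : ysection _ _ = set0).
  by rewrite measure0 -EFinM lee_fin mulr_ge0 ?phi_ge0// ltW.
apply/seteqP; split => w //; rewrite /ysection/= inE/= => -[Ex Ey _].
by case: nE.
Qed.

(** The pieces are the preimages in [E] of the closures of the sets of the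
    cover; this makes them Borel, as sections of a measurable set. *)
Lemma coverable_close_pairs (R : realType) (n m : nat) (E : set 'rV[R]_n)
    (d : measure_display) (Omega : measurableType d)
    (f : Omega -> 'rV[R]_n -> 'rV[R]_m)
    (mu : probability (borel_rV R n) R) (r rho : R) (N : nat) (w : Omega) :
  measurable (E : set (borel_rV R n)) ->
  measurable_fun ([set: Omega] `*` E : set (Omega * borel_rV R n))
       (fun p : Omega * borel_rV R n => f p.1 p.2 : borel_rV R m) ->
  probability_on E mu -> r <= rho -> coverable r (f w @` E) N ->
  (1 <= N%:R%:E * (mu \x mu) (xsection (close_pairs E f rho) w))%E.
Proof.
move=> mE mf muE rrho [U [Ur EU]].
pose B i : set (borel_rV R n) := [set x | E x /\ closure (U i) (f w x)].
apply: (@card_mul_product_ge1 _ _ _ mu _ B).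
- move=> i.
  have mEO : measurable ([set: Omega] `*` E : set (Omega * borel_rV R n)).
    exact: measurableX.
  have mV : measurable (closure (U i) : set (borel_rV R m)).
    by apply: measurable_closed_rV; exact: closed_closure.
  have := measurable_xsection w (mf mEO _ mV).
  congr measurable; apply/seteqP.
  split => x; rewrite /xsection/= inE/=; first by case=> -[].
  by case.
- by apply: measurable_xsection; exact: measurable_close_pairs.
- rewrite -[RHS]muE; congr (mu _); apply/seteqP; split => [x [i _ []]//|x Ex].
  have [i _ Ui] := EU _ (imageP (f w) Ex).
  by exists i => //; split => //; exact: subset_closure.
- move=> i [x y] [[Ex Ux] [Ey Uy]]; rewrite /xsection/= inE/=; split => //.
  by apply: le_trans rrho; apply: closure_enormB_le Ux Uy; rewrite Ur.
Qed.

(** * Almost sure bounds along a sequence *)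

Lemma sum_inv_consecutive (R : realType) (n : nat) :
  \sum_(0 <= k < n) (k.+1%:R * k.+2%:R)^-1 = 1 - n.+1%:R^-1 :> R.
Proof.
elim: n => [|n IH]; first by rewrite big_nil invr1 subrr.
rewrite big_nat_recr//= IH.
have h1 : n.+1%:R != 0 :> R by rewrite pnatr_eq0.
have h2 : n.+2%:R != 0 :> R by rewrite pnatr_eq0.
move: h1 h2; rewrite -[n.+2%:R]natr1; move: (n.+1%:R) => t h1 h2.
by field; rewrite ?h1 ?h2.
Qed.

(** Weighted by 1/((k+1)(k+2)), whose sum is 1, the [X k] add up to a function
    of integral at most [B]; this sum is finite almost everywhere and bounds
    each of its terms. *)
Lemma ae_quadratic_bound (R : realType) d (T : measurableType d)
    (P : {measure set T -> \bar R}) (X : nat -> T -> \bar R) (B : R) :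
  (forall k, measurable_fun setT (X k)) ->
  (forall k w, 0 <= X k w)%E ->
  (forall k, \int[P]_w X k w <= B%:E)%E ->
  {ae P, forall w, exists2 M : R, 0 < M &
     forall k, (X k w <= (M * (k.+1%:R * k.+2%:R))%:E)%E}.
Proof.
move=> mX X0 XB.
have c0 k : 0 < k.+1%:R * k.+2%:R :> R by rewrite mulr_gt0.
pose Y k w := (((k.+1%:R * k.+2%:R)^-1)%:E * X k w)%E.
have Y0 k w : (0 <= Y k w)%E by rewrite mule_ge0// lee_fin invr_ge0 ltW.
have mY k : measurable_fun setT (Y k) by exact: measurable_funeM.
have B0 : 0 <= B.
  by rewrite -lee_fin; apply: le_trans (XB 0%N); exact: integral_ge0.
pose S w := (\sum_(0 <= k <oo) Y k w)%E.
have S0 w : (0 <= S w)%E by apply: nneseries_ge0.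
have mS : measurable_fun setT S.
  by apply: ge0_emeasurable_sum.
have iS : (\int[P]_w S w <= B%:E)%E.
  rewrite integral_nneseries//; apply: lime_le.
    by apply: is_cvg_nneseries => k _ _; exact: integral_ge0.
  apply: nearW => n.
  apply: (@le_trans _ _ (\sum_(0 <= k < n) ((k.+1%:R * k.+2%:R)^-1 * B)%:E)%E).
    apply: lee_sum => k _.
    rewrite ge0_integralZl ?lee_fin ?invr_ge0 ?(ltW (c0 k))//.
    by rewrite EFinM lee_wpmul2l// lee_fin invr_ge0 (ltW (c0 k)).
  rewrite sumEFin lee_fin -mulr_suml sum_inv_consecutive.
  by rewrite ler_piMl// lerBlDr lerDl invr_ge0.
have SI : P.-integrable setT S.
  apply/integrableP; split => //.
  under eq_integral do rewrite gee0_abs//.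
  by rewrite (le_lt_trans iS)// ltry.
apply: filterS (integrable_ae measurableT SI) => w /(_ Logic.I) Sfin.
exists (fine (S w) + 1); first by rewrite ltr_wpDl// fine_ge0.
move=> k; rewrite EFinM -lee_pdivrMr//.
rewrite muleC; apply: (@le_trans _ _ (S w)); last first.
  by rewrite EFinD fineK// leeDl.
apply: le_trans (nneseries_lim_ge k.+1 _) => //.
by rewrite big_nat_recr//= leeDr// sume_ge0.
Qed.

(** * Dimension inequalities *)

(** A factor that is polynomial in [- ln r] does not affect the exponents of
    growth. *)
Lemma box_dim_ge_profile (R : realType) (n m : nat) (s g K : R)
    (E : set 'rV[R]_n) (A : set 'rV[R]_m) :
  compact E -> E !=set0 -> 0 < s -> 0 < g -> 0 < K ->
  (forall r N, 0 < r < 1 -> coverable r A N ->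
     (capacity s (r `^ g) E <= (N%:R * (K * (- ln r + 2) ^+ 2))%:E)%E) ->
  (g%:E * lower_dim_profile s E <= lower_box_dim A)%E /\
  (g%:E * upper_dim_profile s E <= upper_box_dim A)%E.
Proof.
move=> cE E0 s0 g0 K0 CN; apply: limf_einf_esup_powR => // e e_gt0.
near=> r.
have r0 : 0 < r by [].
have r1 : r < 1 by near: r; exact: nbhs_right_lt.
have small : ln (K * (- ln r + 2) ^+ 2) <= e * - ln r.
  by near: r; exact: ln_quadratic_small.
set L := - ln r in small *.
have L0 : 0 < L by rewrite oppr_gt0 ln_lt0// r0.
have [u u0 [_ Cu]] := capacityE cE E0 s0 (powR_gt0 g r0).
have H0 : 0 < K * (L + 2) ^+ 2 by rewrite mulr_gt0// exprn_gt0// addr_gt0.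
rewrite Cu lne_EFin ?invr_gt0// ln_powR -mulrN -/L !inver !gt_eqF ?mulr_gt0//.
rewrite -!EFinM.
have -> : g * (ln u^-1 / (g * L)) = ln u^-1 / L.
  by field; rewrite !gt_eqF.
pose q := u^-1 / (K * (L + 2) ^+ 2).
have q0 : 0 < q by rewrite divr_gt0// invr_gt0.
have covq : (q%:E <= covering_number r A)%E.
  apply: le_ereal_inf_tmp => _ [N /= cN <-].
  by rewrite lee_fin ler_pdivrMr// -lee_fin -Cu CN// r0.
have lnq : ((ln q)%:E <= lne (covering_number r A))%E.
  move: (covering_number r A) covq => [N| |] //=; last by move=> _; exact: leey.
  rewrite lee_fin => qN; have N0 := lt_le_trans q0 qN.
  by rewrite (lt_geF N0) lee_fin ler_ln.
apply: (@le_trans _ _ ((ln q)%:E * (L^-1)%:E + e%:E)%E); last first.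
  by rewrite leeD2r// lee_wpmul2r// lee_fin invr_ge0 ltW.
rewrite -EFinM -EFinD lee_fin /q lnM ?posrE ?invr_gt0//.
rewrite (@lnV _ (_ * _)) ?posrE// mulrDl mulNr -addrA lerDl addrC subr_ge0.
by rewrite ler_pdivrMr.
Unshelve. all: by end_near. Qed.

Theorem theorem2p7 (R : realType) (n m : nat) (n_gt0 : (0 < n)%N)
    (m_gt0 : (0 < m)%N) (E : set 'rV[R]_n) (E_neq0 : E !=set0)
    (E_compact : compact E) (s gamma : R) (s_gt0 : 0 < s) (gamma_gt0 : 0 < gamma)
    (d : measure_display) (Omega : measurableType d) (P : probability Omega R)
    (f : Omega -> 'rV[R]_n -> 'rV[R]_m)
    (f_continuous : forall w : Omega, {within E, continuous (f w)})
    (f_measurable : measurable_fun ([set: Omega] `*` E : set (Omega * borel_rV R n))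
       (fun p : Omega * borel_rV R n => f p.1 p.2 : borel_rV R m))
    (c : R) (c_gt0 : 0 < c)
    (f_prob : forall (x y : 'rV[R]_n) (r : R), E x -> E y -> 0 < r ->
       (P [set w | (enorm (f w x - f w y) <= r)%R] <=
        (c * phi s (r `^ gamma) (x - y))%:E)%E) :
  {ae P, forall w : Omega,
    (gamma%:E * lower_dim_profile s E <= lower_box_dim (f w @` E))%E /\
    (gamma%:E * upper_dim_profile s E <= upper_box_dim (f w @` E))%E}.
Proof.
have mE := measurable_compact_rV E_compact.
pose rad (k : nat) : R := expR (- k%:R).
have rad0 k : 0 < rad k by exact: expR_gt0.
have radg0 k : 0 < rad k `^ gamma by exact: powR_gt0.
have /choice[e e_prop] k : exists e : R,
    0 < e /\ min_energy s (rad k `^ gamma) E = e%:E.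
  by have [e e0 [He _]] := capacityE E_compact E_neq0 s_gt0 (radg0 k); exists e.
have /choice[mu mu_prop] k : exists mu : probability (borel_rV R n) R,
    probability_on E mu /\ (energy s (rad k `^ gamma) mu <= (2 * e k)%:E)%E.
  have [mu muE le2] := near_min_energy E_compact E_neq0 s_gt0 (radg0 k).
  by exists mu; split => //; rewrite EFinM -(e_prop k).2.
pose G k w := (mu k \x mu k)%E (xsection (close_pairs E f (rad k)) w).
(* measures of the close pairs, normalised to have expectation at most 2 c *)
pose X k w := ((e k)^-1%:E * G k w)%E.
have einv0 k : 0 <= (e k)^-1 by rewrite invr_ge0 ltW// (e_prop k).1.
have mG k : measurable_fun setT (G k).
  exact: (measurable_fun_xsection [the probability _ R of (mu k \x mu k)%E]
    (measurable_close_pairs (rad k) mE f_measurable)).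
have : {ae P, forall w, exists2 M : R, 0 < M &
     forall k, (X k w <= (M * (k.+1%:R * k.+2%:R))%:E)%E}.
  apply: (@ae_quadratic_bound _ _ _ P _ (c * 2)) => k.
  - exact: measurable_funeM.
  - by move=> w; rewrite mule_ge0// lee_fin.
  rewrite ge0_integralZl//; last by rewrite lee_fin.
  have -> : (c * 2)%:E = ((e k)^-1%:E * (c * (2 * e k))%:E)%E.
    by rewrite -EFinM; congr EFin; field; rewrite gt_eqF// (e_prop k).1.
  rewrite lee_wpmul2l ?lee_fin//.
  apply: le_trans (expected_close_pairs (mu k) mE f_measurable c_gt0 (rad0 k)
    (fun x y Ex Ey => f_prob x y (rad k) Ex Ey (rad0 k))) _.
  by rewrite [leRHS]EFinM lee_wpmul2l ?lee_fin ?(ltW c_gt0)// (mu_prop k).2.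
move=> /filterS; apply => w [M M0 XM].
apply: (@box_dim_ge_profile _ _ _ _ _ (M * (expR gamma) `^ s)) => //.
  by rewrite mulr_gt0// powR_gt0// expR_gt0.
move=> r N /andP[r0 r1] cN.
set L := - ln r.
have L0 : 0 < L by rewrite oppr_gt0 ln_lt0// r0.
(* the radius of the sequence just above r: r <= rad k < exp(1) * r *)
pose k := Num.truncn L.
have /andP[kL Lk] := truncn_itv (ltW L0).
have rE : r = expR (- L) by rewrite opprK lnK.
have r_le : r <= rad k by rewrite rE ler_expR lerN2.
have rad_le : rad k <= expR 1 * r.
  by rewrite rE -expRD ler_expR; rewrite -natr1 in Lk; lra.
have [u u0 [minu ->]] := capacityE E_compact E_neq0 s_gt0 (powR_gt0 gamma r0).
(* as 1 <= rad k / r <= exp(1), the minimal energies at the radii rad k ^ gamma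
   and r ^ gamma are comparable *)
have ek_le : e k <= (expR gamma) `^ s * u.
  rewrite -lee_fin -(e_prop k).2 EFinM -minu.
  pose l := rad k `^ gamma / r `^ gamma.
  have l1 : 1 <= l.
    rewrite ler_pdivlMr ?powR_gt0// mul1r.
    by rewrite ge0_ler_powR ?nnegrE ?(ltW gamma_gt0) ?(ltW r0) ?(ltW (rad0 k)).
  have lg : l <= expR gamma.
    rewrite ler_pdivrMr ?powR_gt0//.
    have -> : expR gamma = expR 1 `^ gamma by rewrite -expRM mul1r.
    rewrite -powRM ?expR_ge0 ?(ltW r0)//.
    by rewrite ge0_ler_powR ?nnegrE ?mulr_ge0 ?expR_ge0 ?(ltW r0)
      ?(ltW gamma_gt0) ?(ltW (rad0 k)).
  have -> : rad k `^ gamma = l * r `^ gamma.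
    by rewrite mulfVK// gt_eqF// powR_gt0.
  apply: le_trans (min_energy_scale E s_gt0 (powR_gt0 gamma r0) l1) _.
  rewrite lee_wpmul2r//.
    by apply: ltW; exact: min_energy_gt0 (powR_gt0 _ _).
  rewrite lee_fin ge0_ler_powR ?nnegrE ?(ltW s_gt0) ?expR_ge0//.
  by rewrite (le_trans ler01).
have G1 := coverable_close_pairs mE f_measurable (mu_prop k).1 r_le cN.
have GM : (G k w <= (e k * (M * (k.+1%:R * k.+2%:R)))%:E)%E.
  rewrite EFinM -lee_pdivrMl; last exact: (e_prop k).1.
  exact: XM.
rewrite lee_fin -[leLHS]mul1r ler_pdivrMr//.
have := le_trans G1 (lee_wpmul2l _ GM); rewrite lee_fin ler0n => /(_ isT).
rewrite -EFinM lee_fin => /le_trans; apply.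
rewrite -!mulrA ler_wpM2l//.
rewrite [leRHS](_ : _ = (expR gamma `^ s * u) * (M * (L + 2) ^+ 2)).
  2: by ring.
apply: ler_pM => //.
- by rewrite ltW// (e_prop k).1.
- by rewrite !mulr_ge0// ltW.
- rewrite ler_pM2l// expr2 ler_pM//.
    by rewrite -natr1; lra.
  by rewrite -natr1 -natr1; lra.
Qed.
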